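(* Let $p\geq 2$ and $k\geq 1$ be integers and let $k_0=\log_e^* p-1$. Then, with absolute constants implicit in $\Theta(\cdot)$: (1) if $k\leq k_0$, then $\mathrm{b}_k(p)^{1/p}=\Theta\!\left(p/\log_e^{(k)}p\right)$; (2) if $k>k_0$, then $\mathrm{b}_k(p)^{1/p}=\Theta\!\left(p\,(k-k_0)^{1-1/p}\right)=\Theta\!\left(p\cdot\min\{k^{1-1/p},\,k-k_0\}\right)$.
   Context: A $k$-level partition of $[p]$ is a tuple $(T_1,\dots,T_k)$ where $T_1$ is a partition of $[p]$ into nonempty parts and $T_i$ is a refinement of $T_{i-1}$ for $i=2,\dots,k$; $\mathrm{b}_k(p)$ is the number of $k$-level partitions of $[p]$ (the order-$k$ Bell number). $\log_e^{(k)}p$ denotes the $k$-fold iterate of the natural logarithm applied to $p$ ($\log_e^{(0)}p=p$), and $\log_e^*p$ is the smallest $k$ such that $\log_e^{(k)}p\leq 1$. *)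

(* Defs.v *)
From mathcomp Require Import all_boot.
From Stdlib Require Import Reals.

Set Implicit Arguments.
Unset Strict Implicit.
Unset Printing Implicit Defensive.

Definition refines (T : finType) (Q P : {set {set T}}) : bool :=
  [forall B in Q, [exists C in P, B \subset C]].

(* A k-level partition of [p] = 'I_p : a tuple (T_1,...,T_k) (indexed by 'I_k)
   of partitions of 'I_p into nonempty blocks (mathcomp's [partition], which
   requires set0 \notin P), each refining the previous one. *)
Definition is_klevel (k p : nat) (f : {ffun 'I_k -> {set {set 'I_p}}}) : bool :=
  [forall i, partition (f i) [set: 'I_p]] &&
  [forall i, forall j, (nat_of_ord i == (nat_of_ord j).+1) ==> refines (f i) (f j)].

Definition bell_k (k p : nat) : nat :=
  #|[set f : {ffun 'I_k -> {set {set 'I_p}}} | is_klevel f]|.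

Definition iter_ln (k : nat) (x : R) : R := iter k ln x.

Definition is_logstar (x : R) (n : nat) : Prop :=
  (iter_ln n x <= 1)%R /\ (forall m : nat, (m < n)%N -> (1 < iter_ln m x)%R).

(* Main.v *)
(** Grouping the k-level partitions by their finest level gives
    b_(k+1)(p) = sum_j S(p,j) b_k(j), with S the Stirling numbers of the second
    kind; hence the exponential generating function of b_k is exp(E^k(x)), where
    E(x) = e^x - 1.

    Upper bounds: b_k(p) x^p / p! <= E^(k+1)(x) for all x > 0. Take
    x = log^(k) p when k <= k0, where E^k(x) <= p. When k > k0 take
    x = 1/(k-k0+1) and x = 1/(2(k+1)), using E^m(1/t) <= 1/(t-m).

    Lower bounds: the recurrence gives b_(k+m)(j+q) >= (jm)^q b_k(j). Choosing
    m = 1 and j about p/w shows by induction on k that b_k(p) >= (p/(36w))^p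
    whenever w >= 2 and p <= exp^(k)(w). For k > k0, repeatedly halving both the
    number of blocks and the number n = k-k0 of remaining levels yields
    b_k(p) >= (p/108)^p n^(p-1). *)
Require Import Defs.
From HB Require Import structures.
From mathcomp Require Import all_boot.
From Stdlib Require Import Reals Lra FunctionalExtensionality.

Set Implicit Arguments.
Unset Strict Implicit.
Unset Printing Implicit Defensive.

(* [Reals] rebinds the notation to [Nat.pow]. *)
Local Notation "m ^ n" := (expn m n) : nat_scope.

(** * Counting by the finest level *)

Section Partitions.

Variable T : finType.
Implicit Types P Q : {set {set T}}.

Lemma partitionTP P :
  reflect [/\ set0 \notin P, forall x, exists2 B, B \in P & x \in B
           & forall B C x, B \in P -> C \in P -> x \in B -> x \in C -> B = C]
          (partition P [set: T]).
Proof.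
apply: (iffP and3P) => [[/eqP cP tP P0]|[P0 cP tP]]; split=> //.
- by move=> x; apply/bigcupP; rewrite -/(cover P) cP inE.
- move=> B C x PB PC Bx Cx.
  by rewrite -(def_pblock tP PB Bx) -(def_pblock tP PC Cx).
- by apply/eqP/setP=> x; rewrite inE; apply/bigcupP/cP.
- apply/trivIsetP=> B C PB PC; apply: contraR => /pred0Pn[x /andP[Bx Cx]].
  by rewrite (tP B C x).
Qed.

Lemma refinesP Q P :
  reflect (forall B, B \in Q -> exists2 C, C \in P & B \subset C) (refines Q P).
Proof.
apply: (iffP forall_inP) => r B /r; first by case/exists_inP=> C; exists C.
by case=> C PC sBC; apply/exists_inP; exists C.
Qed.

Lemma refines_refl P : refines P P.
Proof. by apply/refinesP=> B PB; exists B. Qed.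

Lemma refines_trans P1 P2 P3 :
  refines P1 P2 -> refines P2 P3 -> refines P1 P3.
Proof.
move=> /refinesP r12 /refinesP r23; apply/refinesP=> B /r12[C /r23[D PD sCD] sBC].
by exists D => //; apply: subset_trans sBC sCD.
Qed.

End Partitions.

(** * Partitions pulled back along a quotient map *)

Section Pullback.

Variables (T U : finType) (s : T -> U).
Hypothesis surj : forall u, exists x, s x = u.

Definition pullback (Q : {set {set U}}) : {set {set T}} :=
  [set s @^-1: B | B : {set U} in Q].

Lemma preimset_surj_sub (B C : {set U}) :
  (s @^-1: B \subset s @^-1: C) = (B \subset C).
Proof.
apply/idP/idP=> [/subsetP sBC|]; last exact: preimsetS.
apply/subsetP=> u; have [x <-] := surj u => Bx.
by have := sBC x; rewrite !inE; apply.
Qed.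

Lemma preimset_surj_inj : injective (fun B : {set U} => s @^-1: B).
Proof.
by move=> B C e; apply/eqP; rewrite eqEsubset -!preimset_surj_sub e subxx.
Qed.

Lemma pullback_inj : injective pullback.
Proof. exact: imset_inj preimset_surj_inj. Qed.

Lemma refines_pullback P Q : refines (pullback P) (pullback Q) = refines P Q.
Proof.
apply/refinesP/refinesP=> r B.
- move=> PB; have [_ /imsetP[C QC ->]] := r _ (imset_f _ PB).
  by rewrite preimset_surj_sub; exists C.
- case/imsetP=> {}B /r[C QC sBC] ->; exists (s @^-1: C); first exact: imset_f.
  by rewrite preimset_surj_sub.
Qed.

Lemma partition_pullback Q :
  partition (pullback Q) [set: T] = partition Q [set: U].
Proof.
apply/partitionTP/partitionTP=> -[n0 cP tP]; split.
- by apply: contra n0 => Q0; apply/imsetP; exists set0; rewrite ?preimset0.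
- move=> u; have [x <-] := surj u; have [_ /imsetP[B QB ->]] := cP x.
  by rewrite inE; exists B.
- move=> B C u QB QC Bu Cu; have [x xu] := surj u.
  apply: preimset_surj_inj; apply: (tP _ _ x); rewrite ?imset_f //;
  by rewrite inE xu.
- apply: contra n0 => /imsetP[B QB /esym B0]; rewrite -(_ : B = set0) //.
  by apply: preimset_surj_inj; rewrite B0 preimset0.
- move=> x; have [B QB Bx] := cP (s x).
  by exists (s @^-1: B); rewrite ?inE ?imset_f.
- move=> _ _ x /imsetP[B QB ->] /imsetP[C QC ->]; rewrite !inE => Bx Cx.
  by rewrite (tP B C (s x)).
Qed.

Variable P : {set {set T}}.
Hypotheses (partP : partition P [set: T])
  (kerP : forall x y, (s x == s y) = (pblock P x == pblock P y)).

Lemma pblock_eqT B x : B \in P -> x \in B -> pblock P x = B.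
Proof. by case/and3P: partP => _ tP _; apply: def_pblock. Qed.

Lemma refines_pullback_ker Q :
  partition Q [set: U] -> refines P (pullback Q).
Proof.
move=> /partitionTP[_ cQ _]; apply/refinesP=> B PB.
have [x Bx] : exists x, x \in B.
  by apply/set0Pn; case/partitionTP: partP => P0 _ _; apply: contraNneq P0 => <-.
have [C QC Cx] := cQ (s x); exists (s @^-1: C); first exact: imset_f.
apply/subsetP=> y By; rewrite inE (_ : s y = s x) //; apply/eqP.
by rewrite kerP !(pblock_eqT PB).
Qed.

(** The fibres of [s] are the blocks of [P], and each block of [Q] is a union of blocks of [P].
    Hence every block of [Q] is saturated: it is the preimage of its own image, and these images
    form [Q']. *)
Lemma pullback_coarser Q :
  partition Q [set: T] -> refines P Q -> exists Q', Q = pullback Q'.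
Proof.
move=> /partitionTP[_ _ tQ] /refinesP rPQ.
have sat B : B \in Q -> s @^-1: (s @: B) = B.
  move=> QB; apply/setP=> y; apply/idP/idP=> [|By]; last by rewrite inE imset_f.
  rewrite inE => /imsetP[x Bx /eqP]; rewrite kerP => /eqP exy.
  case/partitionTP: (partP) => _ cP _; have [B0 PB0 B0x] := cP x.
  have B0y : y \in B0 by rewrite -(pblock_eqT PB0 B0x) -exy mem_pblock;
     case/and3P: partP => /eqP-> _ _; rewrite inE.
  have [C QC /subsetP sB0C] := rPQ _ PB0.
  by rewrite (tQ B C x) ?sB0C.
exists [set s @: B | B : {set T} in Q]; apply/setP=> B; apply/idP/imsetP=> [QB|].
  by exists (s @: B); rewrite ?imset_f ?sat.
by case=> _ /imsetP[C QC ->] ->; rewrite sat.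
Qed.

End Pullback.

(** Numbering the blocks of [P] turns the block map [pblock P] into a map to an ordinal type, so
    that structures on the set of blocks can be counted as structures on ['I_#|P|]. *)
Lemma partition_quotient (T : finType) (P : {set {set T}}) :
  partition P [set: T] -> exists s : T -> 'I_#|P|,
    (forall u, exists x, s x = u) /\
    (forall x y, (s x == s y) = (pblock P x == pblock P y)).
Proof.
move=> pP; have bP x : pblock P x \in P.
  by rewrite pblock_mem //; case/and3P: pP => /eqP-> _ _; rewrite inE.
exists (fun x => enum_rank_in (bP x) (pblock P x)); split=> [u|x y].
- have Pu := enum_valP u; case/partitionTP: (pP) => P0 _ _.
  have [x ux] : exists x, x \in enum_val u.
    by apply/set0Pn; apply: contraNneq P0 => <-.
  exists x; have e := pblock_eqT pP Pu ux.
  by apply: enum_val_inj; rewrite enum_rankK_in.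
- apply/eqP/eqP=> [/(congr1 enum_val)|e]; first by rewrite !enum_rankK_in.
  by apply: enum_val_inj; rewrite !enum_rankK_in.
Qed.

(** * The recurrence on the number of levels *)

Section Levels.

Variables k p : nat.
Implicit Type F : {ffun 'I_k -> {set {set 'I_p}}}.

Lemma klevelP F :
  reflect ((forall i, partition (F i) [set: 'I_p]) /\
           (forall i j : 'I_k, i = j.+1 :> nat -> refines (F i) (F j)))
          (is_klevel F).
Proof.
apply: (iffP andP) => [[/forallP pF /forallP rF]|[pF rF]]; split.
- by [].
- by move=> i j e; have /forallP/(_ j)/implyP-> := rF i; rewrite ?e.
- exact/forallP.
- by apply/forallP=> i; apply/forallP=> j; apply/implyP=> /eqP/rF.
Qed.

Lemma klevel_refines F (i j : 'I_k) : is_klevel F -> j <= i -> refines (F i) (F j).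
Proof.
move=> /klevelP[_ rF]; have [n] := ubnP (i - j); elim: n i => // n IH i lt_n le_ji.
have [e|ne] := eqVneq j i; first by rewrite e refines_refl.
have lt_ji : j < i by rewrite ltn_neqAle ne.
have i1k : i.-1 < k by rewrite (leq_ltn_trans (leq_pred i)).
have i_gt0 : 0 < i by apply: leq_ltn_trans lt_ji.
apply: (@refines_trans _ _ (F (Ordinal i1k))); first by apply: rF; rewrite /= prednK.
apply: IH => /=; last by rewrite -ltnS prednK.
by rewrite -ltnS (leq_trans _ lt_n) // ltnS -subn1 subnAC subn1 prednK ?subn_gt0.
Qed.

End Levels.

(** With the finest level fixed to [P], all other levels are coarser than [P], so they are pullbacks
    along the quotient map. Since pullback is injective and preserves and reflects partitions and
    refinement, these levels amount to a [k]-level partition of the set of blocks. *)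
Lemma card_klevel_last k p (P : {set {set 'I_p}}) : partition P [set: 'I_p] ->
  #|[set F : {ffun 'I_k.+1 -> {set {set 'I_p}}} | is_klevel F && (F ord_max == P)]|
  = bell_k k #|P|.
Proof.
move=> pP; have [s [surj kerP]] := partition_quotient pP.
pose ext (f : {ffun 'I_k -> {set {set 'I_#|P|}}}) : {ffun 'I_k.+1 -> {set {set 'I_p}}} :=
  [ffun i => if unlift ord_max i is Some j then pullback s (f j) else P].
have extM f : ext f ord_max = P by rewrite ffunE unlift_none.
have extL f j : ext f (lift ord_max j) = pullback s (f j) by rewrite ffunE liftK.
have ext_inj : injective ext.
  move=> f g e; apply/ffunP=> j; apply: (pullback_inj surj).
  by rewrite -!extL e.
rewrite /bell_k -(card_imset _ ext_inj); congr #|pred_of_set _|.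
apply/setP=> F; rewrite inE; apply/andP/imsetP=> [[lF /eqP FM]|[f]].
  have /klevelP[pF rF] := lF.
  have cF j : exists Q, F (lift ord_max j) == pullback s Q.
    have [|Q ->] := pullback_coarser pP kerP (pF (lift ord_max j)); last by exists Q.
    by rewrite -FM klevel_refines // leq_ord.
  pose f := [ffun j => xchoose (cF j)]; have Ff j : F (lift ord_max j) = pullback s (f j).
    by rewrite ffunE; apply/eqP; apply: (xchooseP (cF j)).
  exists f; last first.
    apply/ffunP=> i; case: (unliftP ord_max i) => [j|] ->; first by rewrite extL Ff.
    by rewrite extM.
  rewrite inE; apply/klevelP; split=> [i|i j eij].
    by rewrite -(partition_pullback surj) -Ff.
  rewrite -(refines_pullback surj) -!Ff; apply: rF.
  by rewrite !lift_max.
rewrite inE => /klevelP[pf rf] ->; rewrite extM eqxx; split=> //.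
apply/klevelP; split=> [i|i j].
  by case: (unliftP ord_max i) => [j|] ->; rewrite ?extM ?extL ?(partition_pullback surj).
case: (unliftP ord_max i) => [i'|] ->; case: (unliftP ord_max j) => [j'|] ->;
  rewrite ?extM ?extL ?(refines_pullback surj) ?lift_max ?refines_refl //.
- exact: rf.
- by move=> /= e; have := ltn_ord i'; rewrite e ltnNge leqnSn.
- by move=> _; apply: (refines_pullback_ker pP kerP).
Qed.

Lemma bell_kS_sum k p : bell_k k.+1 p =
  \sum_(P : {set {set 'I_p}} | partition P [set: 'I_p]) bell_k k #|P|.
Proof.
rewrite /bell_k -sum1_card.
rewrite (partition_big (fun F : {ffun 'I_k.+1 -> _} => F ord_max)
   (fun P => partition P [set: 'I_p])) /=; last first.
  by move=> F; rewrite inE => /klevelP[pF _].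
apply: eq_bigr => P pP; rewrite -[RHS](card_klevel_last k pP) -sum1_card.
by apply: eq_bigl => F; rewrite !inE.
Qed.

Lemma bell_0 p : bell_k 0 p = 1.
Proof.
transitivity #|{: {ffun 'I_0 -> {set {set 'I_p}}}}|; last by rewrite card_ffun card_ord.
by apply: eq_card => f; rewrite !inE; apply/klevelP; split=> -[].
Qed.

(** * Stirling numbers of the second kind *)

Definition num_partitions p j : nat :=
  #|[set P : {set {set 'I_p}} | partition P [set: 'I_p] & #|P| == j]|.

Lemma card_partition_le p (P : {set {set 'I_p}}) : partition P [set: 'I_p] -> #|P| <= p.
Proof.
move=> pP; have [s [surj _]] := partition_quotient pP.
have -> : #|P| = #|s @: [set: 'I_p]|.
  rewrite -[LHS](card_ord #|P|); apply: eq_card => u; rewrite inE.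
  by have [x <-] := surj u; rewrite imset_f.
by rewrite (leq_trans (leq_imset_card _ _)) // cardsT card_ord.
Qed.

Lemma sum_partitions p (F : nat -> nat) :
  \sum_(P : {set {set 'I_p}} | partition P [set: 'I_p]) F #|P| =
  \sum_(j < p.+1) num_partitions p j * F j.
Proof.
rewrite (partition_big (fun P : {set {set 'I_p}} => inord #|P|) (fun _ : 'I_p.+1 => true)) //=.
apply: eq_bigr => j _; rewrite /num_partitions -sum1_card big_distrl /=.
apply: eq_big => [P|P /andP[pP /eqP <-]].
  rewrite !inE; case pP: (partition P _) => //=.
  by rewrite -val_eqE /= inordK // ltnS card_partition_le.
by rewrite mul1n inordK // ltnS card_partition_le.
Qed.

(** A function whose fibres are the blocks of [P] is the quotient map followed by an injection of
    the blocks into ['I_n], and [n ^_ #|P|] counts these injections. *)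
Lemma card_ffun_kernel p n (P : {set {set 'I_p}}) : partition P [set: 'I_p] ->
  #|[set g : {ffun 'I_p -> 'I_n} | preim_partition g [set: 'I_p] == P]| = n ^_ #|P|.
Proof.
move=> pP; have [s [surj kerP]] := partition_quotient pP.
pose ext (h : {ffun 'I_#|P| -> 'I_n}) : {ffun 'I_p -> 'I_n} := [ffun x => h (s x)].
have ext_inj : injective ext.
  move=> f g e; apply/ffunP=> u; have [x <-] := surj u.
  by have /ffunP/(_ x) := e; rewrite !ffunE.
rewrite -[in RHS](card_ord n) -[in RHS](card_ord #|P|) -card_inj_ffuns.
rewrite -(card_imset _ ext_inj); congr #|pred_of_set _|.
have kerE (g : 'I_p -> 'I_n) x y :
    (pblock (preim_partition g setT) x == pblock (preim_partition g setT) y) = (g x == g y).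
  have pg := preim_partitionP g setT.
  rewrite eq_pblock ?(cover_partition pg) ?(partition_trivIset pg) ?inE //.
  by rewrite pblock_equivalence_partition ?inE //; split=> // /eqP->.
apply/setP=> g; rewrite inE; apply/eqP/imsetP=> [eP|[h]].
  have gs x y : (g x == g y) = (s x == s y) by rewrite kerP -eP kerE.
  have surjb u : exists x, s x == u by have [x <-] := surj u; exists x.
  pose h : {ffun 'I_#|P| -> 'I_n} := [ffun u => g (xchoose (surjb u))].
  have hs x : h (s x) = g x.
    by rewrite ffunE; apply/eqP; rewrite gs; apply: xchooseP (surjb (s x)).
  exists h; last by apply/ffunP=> x; rewrite ffunE.
  rewrite inE; apply/injectiveP=> u v; have [x <-] := surj u; have [y <-] := surj v.
  by rewrite !hs => /eqP; rewrite gs => /eqP.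
rewrite inE => /injectiveP injh ->.
have pg := preim_partitionP (ext h) setT.
have eb x : pblock (preim_partition (ext h) setT) x = pblock P x.
  apply/setP=> y; rewrite -!eq_pblock ?(cover_partition pg) ?(partition_trivIset pg)
    ?(cover_partition pP) ?(partition_trivIset pP) ?inE //.
  by rewrite kerE !ffunE (inj_eq injh) kerP.
have bl (Q : {set {set 'I_p}}) : partition Q setT -> Q = [set pblock Q x | x : 'I_p].
  move=> pQ; apply/setP=> B; apply/idP/imsetP=> [QB|[x _ ->]].
    case/partitionTP: (pQ) => Q0 _ _.
    have [x ux] : exists x, x \in B by apply/set0Pn; apply: contraNneq Q0 => <-.
    by exists x => //; rewrite (pblock_eqT pQ QB).
  by rewrite pblock_mem // (cover_partition pQ) inE.
by rewrite (bl _ pg) (bl _ pP); apply: eq_imset.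
Qed.

(** All functions from ['I_p] to ['I_n] are classified by the partition into their fibres. *)
Lemma expn_sum_ffact p n : n ^ p = \sum_(j < p.+1) num_partitions p j * n ^_ j.
Proof.
rewrite -(sum_partitions p (falling_factorial n)).
rewrite -{1}(card_ord p) -{1}(card_ord n) -card_ffun -cardsT -sum1_card.
rewrite (partition_big (fun g : {ffun 'I_p -> 'I_n} => preim_partition g [set: 'I_p])
   (fun P => partition P [set: 'I_p])) /=; last by move=> g _; apply: preim_partitionP.
apply: eq_bigr => P pP; rewrite -(card_ffun_kernel n pP) -sum1_card.
by apply: eq_bigl => g; rewrite !inE.
Qed.

Fixpoint stirling2 p j : nat :=
  match p, j with
  | 0, 0 => 1
  | p'.+1, j'.+1 => j'.+1 * stirling2 p' j'.+1 + stirling2 p' j'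
  | _, _ => 0
  end.

Lemma stirling2SS p j :
  stirling2 p.+1 j.+1 = j.+1 * stirling2 p j.+1 + stirling2 p j.
Proof. by []. Qed.

Lemma stirling2_small p j : p < j -> stirling2 p j = 0.
Proof.
elim: p j => [|p IH] [|j] //= lt_pj.
by rewrite !IH ?muln0 // ltnW.
Qed.

Lemma stirling2_diag p : stirling2 p p = 1.
Proof. by elim: p => // p IH /=; rewrite stirling2_small // IH muln0. Qed.

(** Multiplying by [n] sends [n ^_ j] to [n ^_ j.+1 + j * n ^_ j], which matches the recurrence of
    [stirling2]. The bound [N] is left free because splitting off the term of index 0 shortens the
    sum by one. *)
Lemma expn_sum_stirling2 p n N : p < N -> n ^ p = \sum_(j < N) stirling2 p j * n ^_ j.
Proof.
elim: p N => [|p IH] [|N] // lt_pN.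
  rewrite big_ord_recl big1 ?addn0 ?mul1n //.
rewrite big_ord_recl add0n expnSr (IH N) // big_distrl /=.
under [RHS]eq_bigr => j _ do rewrite /bump /= add1n mulnDl.
rewrite big_split /=.
have eq1 (j : nat) : stirling2 p j * n ^_ j * n =
    stirling2 p j * n ^_ j.+1 + j * stirling2 p j * n ^_ j.
  rewrite ffactnSr (mulnC j) -mulnA -[in RHS]mulnA -mulnDr; congr (_ * _).
  (* Subtraction truncates: for [n < j] the identity [n - j + j = n] fails, but then the factor
     [n ^_ j] is 0. *)
  rewrite (mulnC j) -mulnDr; case: (leqP j n) => [/subnK->//|lt_nj].
  by rewrite ffact_small.
under eq_bigr => j _ do rewrite eq1.
rewrite big_split /= addnC; congr (_ + _).
case: N lt_pN => // N lt_pN.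
rewrite big_ord_recl mul0n add0n [RHS]big_ord_recr /=.
by rewrite [stirling2 p N.+1]stirling2_small ?muln0 ?addn0.
Qed.

Lemma num_partitionsE p j : num_partitions p j = stirling2 p j.
Proof.
have [lt_pj|] := ltnP p j.
  rewrite stirling2_small //; apply/eqP; rewrite cards_eq0 -subset0.
  apply/subsetP=> P; rewrite inE => /andP[/card_partition_le le_p /eqP e].
  by rewrite e leqNgt lt_pj in le_p.
have [n] := ubnP j; elim: n j => // n IH j lt_jn le_jp.
have := expn_sum_ffact p j; rewrite (expn_sum_stirling2 _ (ltnSn p)).
have tail (f : nat -> nat) : \sum_(i < p.+1) f i * j ^_ i =
     \sum_(i < j) f i * j ^_ i + f j * j`!.
  have le_jp1 : j.+1 <= p.+1 by [].
  rewrite -(big_mkord predT (fun i => f i * j ^_ i)) (big_cat_nat (leq0n _) le_jp1) //=.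
  rewrite [X in _ + X]big_nat_cond.
  rewrite [X in _ + X]big1 ?addn0 ?big_mkord ?big_ord_recr ?ffactnn //=.
  by move=> i /andP[/andP[lt_ji _] _]; rewrite ffact_small ?muln0.
rewrite !tail.
rewrite (eq_bigr (fun i : 'I_j => num_partitions p i * j ^_ i)) => [|i _].
  by move/eqP; rewrite eqn_add2l eqn_pmul2r ?fact_gt0 // => /eqP.
by rewrite IH ?(leq_trans (ltn_ord i)) // ltnW ?(leq_trans (ltn_ord i)).
Qed.

Lemma bell_kS k p N : p < N ->
  bell_k k.+1 p = \sum_(j < N) stirling2 p j * bell_k k j.
Proof.
move=> lt_pN; rewrite bell_kS_sum (sum_partitions p (bell_k k)).
under eq_bigr => j _ do rewrite num_partitionsE.
rewrite -!(big_mkord predT (fun j => stirling2 p j * bell_k k j)).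
rewrite (big_cat_nat (leq0n _) lt_pN) //= [X in _ = _ + X]big_nat_cond.
rewrite [X in _ + X]big1 ?addn0 // => j /andP[/andP[lt_pj _] _].
by rewrite stirling2_small.
Qed.

(** The left side counts the partitions in which [j] given elements lie in different blocks, [t] of
    the other [q] elements are singletons, and each remaining element joins one of the [j] blocks.
    The proof compares Pascal's rule with the Stirling recurrence. *)
Lemma stirling2_lower j q t : t <= q ->
  'C(q, t) * j ^ (q - t) <= stirling2 (j + q) (j + t).
Proof.
elim: q t => [|q IH] [|t] //; rewrite ?addn0 ?stirling2_diag //.
  move=> _; case: j IH => [|j] IH; first by rewrite subn0 exp0n ?muln0.
  rewrite bin0 mul1n subn0 addnS /=; have := IH 0 isT.
  rewrite bin0 mul1n subn0 addn0 => {}IH.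
  by rewrite expnS (leq_trans _ (leq_addr _ _)) // leq_mul.
rewrite ltnS !addnS binS mulnDl subSS /= => le_tq; apply: leq_add; last exact: IH.
move: le_tq; rewrite leq_eqVlt => /predU1P[->|lt_tq]; first by rewrite bin_small.
rewrite -(subnSK lt_tq) expnS mulnCA leq_mul //; last by rewrite -addnS IH.
by rewrite -addnS leq_addr.
Qed.

(** Induction on [m]: among the possible sizes of the finest level only [j + t] with [t <= q] are
    kept, and the binomial theorem sums the terms ['C(q, t) * j ^ (q - t) * (j * m) ^ t] to
    [(j + j * m) ^ q]. *)
Lemma bell_lower k m j q : (j * m) ^ q * bell_k k j <= bell_k (k + m) (j + q).
Proof.
elim: m q => [|m IH] q.
  by rewrite muln0 addn0; case: q => [|q]; rewrite ?addn0 ?mul1n // exp0n.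
rewrite addnS (bell_kS _ (ltnSn _)) -addnS big_split_ord /=.
apply: leq_trans (leq_addl _ _).
rewrite mulnS expnDn big_distrl /=; apply: leq_sum => t _.
have le_tq : t <= q by rewrite -ltnS.
rewrite mulnA -mulnA leq_mul ?IH ?stirling2_lower //.
Qed.

Lemma bell_gt0 k p : 0 < bell_k k p.
Proof.
have := bell_lower 0 k p 0; rewrite expn0 mul1n bell_0 addn0; exact.
Qed.

Lemma bell_p0 k : bell_k k 0 = 1.
Proof.
by elim: k => [|k IH]; rewrite ?bell_0 // (bell_kS _ (ltnSn 0)) big_ord1 IH.
Qed.

(** * Upper bounds from generating functions *)

HB.instance Definition _ := Monoid.isComLaw.Build R 0%R Rplus
  (fun x y z => esym (Rplus_assoc x y z)) Rplus_comm Rplus_0_l.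

Local Notation "\rsum_ ( i < n ) F" := (\big[Rplus/0%R]_(i < n) F%R)
  (at level 41, F at level 41, i, n at level 50).

Lemma rsum_le n (F G : 'I_n -> R) :
  (forall i, (F i <= G i)%R) -> (\rsum_(i < n) F i <= \rsum_(i < n) G i)%R.
Proof.
move=> le_FG; apply: (big_ind2 Rle) => //; first exact: Rle_refl.
by move=> *; apply: Rplus_le_compat.
Qed.

Lemma rsum_mulr n (F : 'I_n -> R) (a : R) :
  (\rsum_(i < n) (a * F i) = a * \rsum_(i < n) F i)%R.
Proof.
by rewrite (big_morph (Rmult a) (Rmult_plus_distr_l a) (Rmult_0_r a)).
Qed.

Lemma rsum_ends_le p (a : nat -> R) : (forall i, (0 <= a i)%R) ->
  (a O + a p.+1 <= \rsum_(i < p.+2) a i)%R.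
Proof.
move=> a0; rewrite big_ord_recl big_ord_recr /=.
set s := \big[_/_]_(_ < _) _; have s0 : (0 <= s)%R; last by rewrite /bump /= add1n; lra.
by apply: (big_ind (Rle 0)) => // [|y z]; [apply: Rle_refl|apply: Rplus_le_le_0_compat].
Qed.

Lemma INR_sum n (F : 'I_n -> nat) :
  INR (\sum_(i < n) F i) = \rsum_(i < n) INR (F i).
Proof. by apply: big_morph => // x y; rewrite -plus_INR. Qed.

(** The mean value theorem for [g - f]. Truncated generating functions are compared with their
    closed forms through derivatives, without any convergence argument. *)
Lemma le_of_derive_le (f g f' g' : R -> R) (x : R) :
  (0 <= x)%R -> (f 0 <= g 0)%R ->
  (forall c, (0 <= c)%R -> derivable_pt_lim f c (f' c)) ->
  (forall c, (0 <= c)%R -> derivable_pt_lim g c (g' c)) ->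
  (forall c, (0 <= c)%R -> (f' c <= g' c)%R) -> (f x <= g x)%R.
Proof.
move=> x0 fg0 df dg le'.
have [->//|x_gt0] : x = 0%R \/ (0 < x)%R by lra.
have [|c [e [c0 cx]]] := @MVT_cor2 (fun y => g y - f y)%R (fun y => g' y - f' y)%R 0 x x_gt0.
  by move=> c [c0 _]; apply: derivable_pt_lim_minus; [apply: dg|apply: df].
have := le' c (Rlt_le _ _ c0) => le_c.
have : (0 <= (g' c - f' c) * (x - 0))%R by apply: Rmult_le_pos; lra.
by lra.
Qed.

Lemma INR_fact_gt0 n : (0 < INR n`!)%R.
Proof. by apply: lt_0_INR; apply/ltP; apply: fact_gt0. Qed.

Lemma INR_factS n : INR (n.+1)`! = (INR n.+1 * INR n`!)%R.
Proof. by rewrite factS mult_INR. Qed.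

Lemma derivable_egf (a : nat -> R) N x :
  derivable_pt_lim (fun y => \rsum_(p < N.+1) (a p * (y ^ p / INR p`!)))
    x (\rsum_(p < N) (a p.+1 * (x ^ p / INR p`!))).
Proof.
elim: N => [|N IH].
  rewrite big_ord0 (_ : (fun y => _) = fct_cte (a O * (1 / 1))%R);
    first exact: derivable_pt_lim_const.
  by apply: functional_extensionality => y; rewrite big_ord1.
rewrite big_ord_recr /=.
rewrite (_ : (fun y => _) = ((fun y => \rsum_(p < N.+1) (a p * (y ^ p / INR p`!))) +
   mult_real_fct (a N.+1 / INR (N.+1)`!) (fun y => pow y N.+1))%F); last first.
  apply: functional_extensionality => y; rewrite big_ord_recr /=.
  by rewrite /plus_fct /mult_real_fct /=; congr Rplus; rewrite /Rdiv; ring.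
apply: derivable_pt_lim_plus => //.
rewrite (_ : Rmult _ _ = (a N.+1 / INR (N.+1)`! * (INR N.+1 * x ^ N))%R).
  exact/derivable_pt_lim_scal/derivable_pt_lim_pow.
rewrite INR_factS; have := INR_fact_gt0 N; have := lt_0_INR N.+1 (Nat.lt_0_succ N) => *.
by field; split; lra.
Qed.

Definition expm1 (x : R) : R := (exp x - 1)%R.

Lemma expm1_ge0 x : (0 <= x)%R -> (0 <= expm1 x)%R.
Proof. by move=> x0; rewrite /expm1; have := exp_ineq1_le x; lra. Qed.

(** Induction on the truncation [N]: differentiating the sum shifts its coefficients and lowers [N]
    by one, and the derivative of [expm1 y ^ j.+1 / (j.+1)!] satisfies the same recurrence as
    [stirling2], because [exp = expm1 + 1]. *)
Lemma stirling2_egf_le j N x : (0 <= x)%R ->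
  (\rsum_(p < N) (INR (stirling2 p j) * (x ^ p / INR p`!)) <= expm1 x ^ j / INR j`!)%R.
Proof.
have ge0 i y : (0 <= y)%R -> (0 <= expm1 y ^ i / INR i`!)%R.
  move=> /expm1_ge0 y0; apply: Rmult_le_pos; first exact: pow_le.
  exact/Rlt_le/Rinv_0_lt_compat/INR_fact_gt0.
elim: N j x => [|N IH] j x x0; first by rewrite big_ord0; apply: ge0.
case: j => [|j].
  rewrite big_ord_recl big1 => [|i _]; last by rewrite /= Rmult_0_l.
  by rewrite /= /Rdiv; lra.
apply: (@le_of_derive_le
  (fun y => \rsum_(p < N.+1) (INR (stirling2 p j.+1) * (y ^ p / INR p`!)))
  (fun y => expm1 y ^ j.+1 / INR (j.+1)`!)%R
  (fun y => \rsum_(p < N) (INR (stirling2 p.+1 j.+1) * (y ^ p / INR p`!)))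
  (fun y => INR j.+1 * (expm1 y ^ j.+1 / INR (j.+1)`!) + expm1 y ^ j / INR j`!)%R) => //.
- rewrite big_ord_recl big1 => [|i _]; last by rewrite /= /Rdiv; ring.
  by rewrite /expm1 exp_0 /= /Rdiv; lra.
- by move=> c _; apply: (derivable_egf (fun p => INR (stirling2 p j.+1))).
- move=> c _.
  rewrite (_ : (fun y => _) = mult_real_fct (/ INR (j.+1)`!)
      (comp (fun z => pow z j.+1) expm1)); last first.
    by apply: functional_extensionality => y; rewrite /mult_real_fct /comp /Rdiv; ring.
  rewrite (_ : Rplus _ _ = (/ INR (j.+1)`! * ((INR j.+1 * expm1 c ^ j) * (exp c - 0)))%R).
    apply: derivable_pt_lim_scal; apply: derivable_pt_lim_comp.
      apply: derivable_pt_lim_minus; [exact: derivable_pt_lim_exp|exact: derivable_pt_lim_const].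
    exact: derivable_pt_lim_pow.
  rewrite INR_factS; have := INR_fact_gt0 j; have := lt_0_INR j.+1 (Nat.lt_0_succ j) => *.
  have -> : exp c = (expm1 c + 1)%R by rewrite /expm1; ring.
  by rewrite -tech_pow_Rmult; field; split; lra.
- move=> c c0.
  under eq_bigr => p _ do rewrite stirling2SS plus_INR mult_INR Rmult_plus_distr_r Rmult_assoc.
  rewrite big_split /= rsum_mulr; apply: Rplus_le_compat; last exact: IH.
  by apply: Rmult_le_compat_l; [exact: (pos_INR j.+1)|apply: IH].
Qed.

Lemma exp_taylor_le N x : (0 <= x)%R -> (\rsum_(p < N) (1 * (x ^ p / INR p`!)) <= exp x)%R.
Proof.
elim: N x => [|N IH] x x0; first by rewrite big_ord0; apply/Rlt_le/exp_pos.
apply: (@le_of_derive_le (fun y => \rsum_(p < N.+1) (1 * (y ^ p / INR p`!))) exp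
  (fun y => \rsum_(p < N) (1 * (y ^ p / INR p`!))) exp) => //.
- rewrite big_ord_recl big1 => [|i _]; last by rewrite /= /Rdiv; ring.
  by rewrite exp_0 /= /Rdiv; lra.
- by move=> c _; apply: (derivable_egf (fun=> 1%R)).
- by move=> c _; apply: derivable_pt_lim_exp.
Qed.

(** Expanding [bell_k k.+1 p] with the common bound [N] gives a square double sum. After exchanging
    the sums, each inner one is a Stirling generating function, and the induction hypothesis applies
    at [expm1 x]. *)
Lemma bell_egf_le k N x : (0 <= x)%R ->
  (\rsum_(p < N) (INR (bell_k k p) * (x ^ p / INR p`!)) <= exp (iter k expm1 x))%R.
Proof.
elim: k x => [|k IH] x x0.
  under eq_bigr => p _ do rewrite bell_0.
  exact: exp_taylor_le.
have -> : \rsum_(p < N) (INR (bell_k k.+1 p) * (x ^ p / INR p`!)) =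
  \rsum_(j < N) (INR (bell_k k j) * \rsum_(p < N) (INR (stirling2 p j) * (x ^ p / INR p`!))).
  under [RHS]eq_bigr => j _ do rewrite -rsum_mulr.
  rewrite exchange_big /=; apply: eq_bigr => p _.
  rewrite (bell_kS _ (ltn_ord p)) INR_sum Rmult_comm -rsum_mulr; apply: eq_bigr => j _.
  by rewrite mult_INR; ring.
rewrite iterSr; apply: Rle_trans (IH _ (expm1_ge0 x0)); apply: rsum_le => j.
by apply: Rmult_le_compat_l; [apply: pos_INR|apply: stirling2_egf_le].
Qed.

Lemma INR_expn m n : INR (m ^ n) = (INR m ^ n)%R.
Proof. by elim: n => // n IH; rewrite expnS mult_INR IH. Qed.

Lemma fact_le_pow p : (INR p`! <= INR p ^ p)%R.
Proof.
rewrite -INR_expn; apply/le_INR/leP.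
suff: forall n, n <= p -> n`! <= p ^ n by apply.
elim=> // n IH lt_np; rewrite factS expnS leq_mul //; exact/IH/ltnW.
Qed.

(* Dropping the constant term 1 of the generating function matters when
   [iter k expm1 x] is small. *)
Lemma bell_term_le k p x : (0 < p)%N -> (0 < x)%R ->
  (INR (bell_k k p) * x ^ p <= INR p ^ p * expm1 (iter k expm1 x))%R.
Proof.
case: p => // p _ x0.
pose a q := (INR (bell_k k q) * (x ^ q / INR q`!))%R.
have a0 q : (0 <= a q)%R.
  apply: Rmult_le_pos; first exact: pos_INR.
  apply: Rmult_le_pos; last exact/Rlt_le/Rinv_0_lt_compat/INR_fact_gt0.
  exact: (pow_le x q (Rlt_le _ _ x0)).
have h := Rle_trans _ _ _ (rsum_ends_le p a0) (@bell_egf_le k p.+2 x (Rlt_le _ _ x0)).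
move: h; rewrite {1}/a bell_p0 fact0 /=.
set G := exp _; rewrite /a; set t := (x ^ p.+1)%R => h.
have F0 := INR_fact_gt0 p.+1; have Fp := fact_le_pow p.+1.
have h2 : (INR (bell_k k p.+1) * (t / INR (p.+1)`!) <= G - 1)%R by lra.
have t0 : (0 < t)%R by apply: pow_lt.
have b0 : (0 <= INR (bell_k k p.+1) * (t / INR (p.+1)`!))%R.
  apply: Rmult_le_pos; first exact: pos_INR.
  by apply: Rlt_le; apply: Rdiv_lt_0_compat.
rewrite /expm1 -/G.
have -> : (INR (bell_k k p.+1) * t = INR (p.+1)`! * (INR (bell_k k p.+1) * (t / INR (p.+1)`!)))%R.
  by field; lra.
apply: Rmult_le_compat => //; lra.
Qed.

(** * Iterates of [expm1], [exp] and [ln] *)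

Lemma expm1_le x y : (x <= y)%R -> (expm1 x <= expm1 y)%R.
Proof.
rewrite /expm1 => -[lt_xy|->]; last lra.
by have := exp_increasing _ _ lt_xy; lra.
Qed.

Lemma iter_expm1_le m x y : (x <= y)%R -> (iter m expm1 x <= iter m expm1 y)%R.
Proof. by elim: m => //= m IH /IH /expm1_le. Qed.

Lemma exp_le x y : (x <= y)%R -> (exp x <= exp y)%R.
Proof. by move=> /expm1_le; rewrite /expm1; lra. Qed.

Lemma iter_exp_le m x y : (x <= y)%R -> (iter m exp x <= iter m exp y)%R.
Proof. by elim: m => //= m IH /IH /exp_le. Qed.

Lemma iter_expm1_le_exp m x : (iter m expm1 x <= iter m exp x)%R.
Proof. by elim: m => [|m IH] /=; [lra | have := expm1_le IH; rewrite /expm1; lra]. Qed.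

(* In the coordinate [t = 1/x], one application of [expm1] costs at most 1. *)
Lemma iter_expm1_inv_le m t : (INR m < t)%R -> (iter m expm1 (/ t) <= / (t - INR m))%R.
Proof.
elim: m => [|m IH] lt_mt; first by rewrite /= Rminus_0_r; lra.
rewrite S_INR in lt_mt *; rewrite iterS.
have {}IH := IH ltac:(lra); apply: Rle_trans (expm1_le IH) _.
have : (0 < t - INR m - 1)%R by lra.
set u := (t - INR m)%R => u1; have -> : (t - (INR m + 1) = u - 1)%R by rewrite /u; ring.
(* From [exp (- / u) >= 1 - / u] follows [exp (/ u) <= u / (u - 1)], that is
   [expm1 (/ u) <= / (u - 1)]. *)
have e1 := exp_ineq1_le (- / u); have e2 := exp_pos (/ u).
have e3 : (exp (/ u) * exp (- / u) = 1)%R by rewrite -exp_plus Rplus_opp_r exp_0.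
have e4 : (exp (/ u) * (1 - / u) <= 1)%R by rewrite -e3; apply: Rmult_le_compat_l; lra.
have e5 : (1 - / u = (u - 1) / u)%R by field; lra.
rewrite /expm1; apply: (Rmult_le_reg_r (u - 1)); first lra.
rewrite Rinv_l; last lra.
have := Rmult_le_compat_r u _ _ ltac:(lra) e4; rewrite e5.
have -> : (exp (/ u) * ((u - 1) / u) * u = exp (/ u) * (u - 1))%R by field; lra.
lra.
Qed.

Lemma iter_exp_ln m x :
  (forall i, (i < m)%N -> (1 < iter_ln i x)%R) -> iter m exp (iter_ln m x) = x.
Proof.
elim: m => // m IH h; rewrite iterSr /iter_ln iterS -/(iter_ln m x) exp_ln.
  by apply: IH => i lt_im; apply: h; apply: ltnW.
by have := h m (ltnSn m); lra.
Qed.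

(** Each logarithm lowers its argument by at least 1, since [1 + ln y <= y]. In the theorem this
    gives [k0 <= p]. *)
Lemma iter_ln_le m x :
  (forall i, (i < m)%N -> (1 < iter_ln i x)%R) -> (iter_ln m x <= x - INR m)%R.
Proof.
elim: m => [|m IH] h; first by rewrite /iter_ln /=; lra.
have := IH (fun i lt_im => h i (ltnW lt_im)).
have := h m (ltnSn m); rewrite /iter_ln iterS -/(iter_ln m x) S_INR => h1 h2.
have := exp_ineq1_le (ln (iter_ln m x)); rewrite exp_ln; lra.
Qed.

(** * Bounds on [p]-th roots *)

Lemma root_le (b p : nat) y : (0 < b)%N -> (0 < p)%N -> (0 < y)%R ->
  (INR b <= y ^ p)%R -> (Rpower (INR b) (1 / INR p) <= y)%R.
Proof.
move=> b0 p0 y0 h; have b0' : (0 < INR b)%R by apply/lt_0_INR/ltP.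
have p0' : (0 < INR p)%R by apply/lt_0_INR/ltP.
have i0 : (0 < 1 / INR p)%R by apply: Rdiv_lt_0_compat; lra.
apply: (Rle_trans _ (Rpower (y ^ p) (1 / INR p))).
  by apply: Rle_Rpower_l; lra.
rewrite -Rpower_pow // Rpower_mult (_ : (INR p * (1 / INR p) = 1)%R); last by field; lra.
rewrite Rpower_1 //; lra.
Qed.

Lemma root_ge (b p : nat) y : (0 < p)%N -> (0 < y)%R ->
  (y ^ p <= INR b)%R -> (y <= Rpower (INR b) (1 / INR p))%R.
Proof.
move=> p0 y0 h; have yp0 := pow_lt y p y0.
have p0' : (0 < INR p)%R by apply/lt_0_INR/ltP.
have i0 : (0 < 1 / INR p)%R by apply: Rdiv_lt_0_compat; lra.
apply: (Rle_trans _ (Rpower (y ^ p) (1 / INR p))); last by apply: Rle_Rpower_l; lra.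
rewrite -Rpower_pow // Rpower_mult (_ : (INR p * (1 / INR p) = 1)%R); last by field; lra.
rewrite Rpower_1 //; lra.
Qed.

Lemma INR_gt0 n : (0 < n)%N -> (0 < INR n)%R.
Proof. by move=> n0; apply/lt_0_INR/ltP. Qed.

Lemma INR_ge1 n : (0 < n)%N -> (1 <= INR n)%R.
Proof. by move=> n0; apply: (le_INR 1); apply/leP. Qed.

Lemma pow_le_div (b x z : R) p : (0 < x)%R -> (b * x ^ p <= z ^ p)%R -> (b <= (z / x) ^ p)%R.
Proof.
move=> x0 h; have xp := pow_lt x p x0.
apply: (Rmult_le_reg_r (x ^ p)) => //; rewrite -Rpow_mult_distr.
by rewrite (_ : (z / x * x = z)%R) //; field; lra.
Qed.

(** The generating function contributes at most [exp p], hence a factor [exp 1] after the root. *)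
Lemma bell_root_le_exp k p x : (0 < p)%N -> (0 < x)%R -> (iter k expm1 x <= INR p)%R ->
  (Rpower (INR (bell_k k p)) (1 / INR p) <= exp 1 * (INR p / x))%R.
Proof.
move=> p0 x0 le_p; have P0 := INR_gt0 p0; have e0 := exp_pos 1.
have px0 : (0 < INR p / x)%R by apply: Rdiv_lt_0_compat.
apply: root_le; rewrite ?bell_gt0 //; first exact: Rmult_lt_0_compat.
rewrite (_ : (exp 1 * (INR p / x) = (INR p * exp 1) / x)%R); last by field; lra.
apply: pow_le_div => //; apply: Rle_trans (bell_term_le k p0 x0) _.
rewrite Rpow_mult_distr; apply: Rmult_le_compat_l; first exact/pow_le/Rlt_le.
rewrite -Rpower_pow // /Rpower ln_exp Rmult_1_r.
by have := exp_le le_p; rewrite /expm1; lra.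
Qed.

Lemma root_expn_pred n p : (0 < n)%N -> (0 < p)%N ->
  (Rpower (INR n) (1 - 1 / INR p) ^ p = INR n ^ p.-1)%R.
Proof.
move=> n0 p0; have N0 := INR_gt0 n0; have P0 := INR_gt0 p0.
rewrite -Rpower_pow; last exact: exp_pos.
rewrite Rpower_mult -Rpower_pow //; congr Rpower.
case: p p0 P0 => // p _; rewrite S_INR /= => P0; field; lra.
Qed.

(** At [x = 1 / (2 (k + 1))] the iterate of order [k + 1] is at most [1 / (k + 1)]. This small
    factor lowers the exponent of [k + 1] from [p] to [p - 1]. *)
Lemma bell_root_le_levels k p : (0 < p)%N ->
  (Rpower (INR (bell_k k p)) (1 / INR p) <= 2 * (INR p * Rpower (INR k.+1) (1 - 1 / INR p)))%R.
Proof.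
move=> p0; have P0 := INR_gt0 p0; have K0 := INR_gt0 (ltn0Sn k).
have r0 : (0 < Rpower (INR k.+1) (1 - 1 / INR p))%R by apply: exp_pos.
apply: root_le; rewrite ?bell_gt0 //.
  by apply: Rmult_lt_0_compat; [lra | apply: Rmult_lt_0_compat].
rewrite !Rpow_mult_distr root_expn_pred //.
have x0 : (0 < / (2 * INR k.+1))%R by apply: Rinv_0_lt_compat; lra.
have := bell_term_le k p0 x0; rewrite -iterS.
have := @iter_expm1_inv_le k.+1 (2 * INR k.+1) ltac:(lra).
rewrite (_ : (2 * INR k.+1 - INR k.+1 = INR k.+1)%R); last ring.
set E := iter _ _ _ => hE h.
have X0 : (0 < (2 * INR k.+1) ^ p)%R by apply: pow_lt; lra.
have := Rmult_le_compat_r _ _ _ (Rlt_le _ _ X0) h.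
rewrite Rmult_assoc -Rpow_mult_distr Rinv_l ?pow1 ?Rmult_1_r; last lra.
move/Rle_trans; apply.
have pp : (0 <= INR p ^ p)%R by apply/pow_le/Rlt_le.
apply: (Rle_trans _ (INR p ^ p * / INR k.+1 * (2 * INR k.+1) ^ p)).
  apply: Rmult_le_compat_r; first exact: Rlt_le.
  exact: Rmult_le_compat_l.
rewrite Rpow_mult_distr; have -> : (INR k.+1 ^ p = INR k.+1 * INR k.+1 ^ p.-1)%R.
  by rewrite -{1}(prednK p0) tech_pow_Rmult.
by right; field; lra.
Qed.

(** * Lower bounds *)

(** The witness is the integer part of [p / w]; as it is at least 1, it is at least half of
    [p / w]. *)
Lemma nat_quotient p w : (1 <= w)%R -> (w <= INR p)%R ->
  exists j, [/\ (0 < j)%N, (j <= p)%N, (INR j * w <= INR p)%R & (INR p <= 2 * (INR j * w))%R].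
Proof.
move=> w1 wp; have z1 : (1 <= INR p / w)%R.
  by apply: (Rmult_le_reg_r w); [lra|rewrite /Rdiv Rmult_assoc Rinv_l; lra].
have zw : (INR p / w * w = INR p)%R by field; lra.
have [h1 h2] := base_Int_part (INR p / w).
have i0 : (0 <= Int_part (INR p / w))%Z by apply/Z.lt_succ_r; apply: lt_IZR; rewrite succ_IZR; lra.
have [j jE] := IZN _ i0; rewrite jE -INR_IZR_INZ in h1 h2.
have j1 : (0 < j)%N by rewrite lt0n; apply/eqP=> j0; rewrite j0 /= in h2; lra.
have J1 := INR_ge1 j1.
have jw : (INR j * w <= INR p)%R by rewrite -zw; apply: Rmult_le_compat_r; lra.
exists j; split=> //.
- apply/leP/INR_le; apply: Rle_trans jw; rewrite -{1}(Rmult_1_r (INR j)).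
  by apply: Rmult_le_compat_l; lra.
- rewrite -zw -Rmult_assoc; apply: Rmult_le_compat_r; lra.
Qed.

Lemma bell_lower_real k m j p : (j <= p)%N ->
  ((INR j * INR m) ^ (p - j) * INR (bell_k k j) <= INR (bell_k (k + m) p))%R.
Proof.
move=> le_jp; rewrite -mult_INR -INR_expn -mult_INR; apply/le_INR/leP.
by rewrite -{2}(subnKC le_jp) bell_lower.
Qed.

Lemma bell_ge1 k p : (1 <= INR (bell_k k p))%R.
Proof. exact/INR_ge1/bell_gt0. Qed.

Lemma pow_le1 x n : (0 <= x <= 1)%R -> (x ^ n <= 1)%R.
Proof. by move=> h; rewrite -(pow1 n); apply: pow_incr; lra. Qed.

(* The finest level is made of about [p / w] blocks. *)
Lemma bell_lower_step k p A D w :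
  (1 <= w)%R -> (0 < A)%R -> (1 <= D)%R ->
  (forall j, (0 < j)%N -> (j <= p)%N -> ((INR j / (A * exp w)) ^ j <= INR (bell_k k j))%R) ->
  (forall j, (INR j * w <= INR p)%R -> (A ^ j <= D ^ p)%R) ->
  ((INR p / (6 * D * w)) ^ p <= INR (bell_k k.+1 p))%R.
Proof.
move=> w1 A0 D1 hb hA; have P0 := pos_INR p; have ew := exp_pos w.
have Dw : (1 <= D * w)%R by rewrite -(Rmult_1_r 1); apply: Rmult_le_compat; lra.
(* If [p < w], the base of the power is below 1 and the bound is trivial. *)
have [lt_pw|le_wp] : (INR p < w)%R \/ (w <= INR p)%R by lra.
  apply: Rle_trans (bell_ge1 _ _); apply: pow_le1; split.
    by apply: Rmult_le_pos => //; apply/Rlt_le/Rinv_0_lt_compat; lra.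
  apply: (Rmult_le_reg_r (6 * D * w)); first lra.
  rewrite /Rdiv Rmult_assoc Rinv_l; last lra.
  have : (w <= D * w)%R by rewrite -{1}(Rmult_1_l w); apply: Rmult_le_compat_r; lra.
  lra.
have [j [j0 jp jw pj]] := nat_quotient w1 le_wp.
have J1 := INR_ge1 j0.
have h := bell_lower_real k 1 jp; rewrite addn1 Rmult_1_r in h.
apply: Rle_trans h.
apply: (Rle_trans _ (INR j ^ (p - j) * (INR j / (A * exp w)) ^ j)%R); last first.
  by apply: Rmult_le_compat_l; [apply: pow_le; lra|apply: hb].
have Aew : (0 < A * exp w)%R by apply: Rmult_lt_0_compat.
(* The denominator is harmless: [j * w <= p] gives [exp w ^ j <= exp p <= 3 ^ p], and
   [A ^ j <= D ^ p] by hypothesis. Then [p <= 2 * j * w] turns [j / (3 * D)] into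
   [p / (6 * D * w)]. *)
have -> : (INR j ^ (p - j) * (INR j / (A * exp w)) ^ j = INR j ^ p / (A ^ j * exp w ^ j))%R.
  rewrite /Rdiv Rpow_mult_distr -Rmult_assoc -pow_add plusE subnK //.
  by rewrite -Rpow_mult_distr pow_inv.
apply: (Rle_trans _ (INR j ^ p / (D ^ p * 3 ^ p))%R).
  have -> : (INR j ^ p / (D ^ p * 3 ^ p) = (INR j / (D * 3)) ^ p)%R.
    by rewrite /Rdiv -Rpow_mult_distr -pow_inv -Rpow_mult_distr.
  apply: pow_incr; split.
    by apply: Rmult_le_pos => //; apply/Rlt_le/Rinv_0_lt_compat; lra.
  apply: (Rmult_le_reg_r (6 * D * w)); first lra.
  rewrite /Rdiv Rmult_assoc Rinv_l; last lra.
  have -> : (INR j * / (D * 3) * (6 * D * w) = 2 * (INR j * w))%R by field; lra.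
  lra.
apply: Rmult_le_compat_l; first by apply: pow_le; lra.
apply: Rinv_le_contravar; first by apply: Rmult_lt_0_compat; apply: pow_lt; lra.
apply: Rmult_le_compat; [apply: pow_le; lra|apply: pow_le; lra|exact: hA|].
rewrite -Rpower_pow // /Rpower ln_exp; apply: Rle_trans (exp_le jw) _.
rewrite -(Rmult_1_r (INR p)) -{1}(ln_exp 1) -/(Rpower (exp 1) (INR p)).
rewrite Rpower_pow; last exact: exp_pos.
by apply: pow_incr; have := exp_le_3; have := exp_pos 1; lra.
Qed.

(** The constant 36 reproduces itself: for [w >= 2] the condition [j * w <= p] gives [2 * j <= p],
    so [36 ^ j <= 6 ^ p], and the step with [D = 6] returns [6 * 6 = 36]. *)
Lemma bell_lower_tower k p w : (2 <= w)%R -> (INR p <= iter k exp w)%R ->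
  ((INR p / (36 * w)) ^ p <= INR (bell_k k p))%R.
Proof.
elim: k p w => [|k IH] p w w2 le_p.
  apply: Rle_trans (bell_ge1 _ _); apply: pow_le1; have P0 := pos_INR p; split.
    by apply: Rmult_le_pos => //; apply/Rlt_le/Rinv_0_lt_compat; lra.
  apply: (Rmult_le_reg_r (36 * w)); first lra.
  by rewrite /Rdiv Rmult_assoc Rinv_l; rewrite /= in le_p; lra.
rewrite (_ : 36 * w = 6 * 6 * w)%R; last ring.
apply: (@bell_lower_step k p 36); [lra|lra|lra| |].
- move=> j j0 jp; apply: IH; first by have := exp_ineq1_le w; lra.
  by rewrite -iterSr; apply: Rle_trans le_p; apply/le_INR/leP.
- move=> j jw; have -> : (36 = 6 ^ 2)%R by ring.
  rewrite -pow_mult; apply: Rle_pow; first lra.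
  apply: INR_le; rewrite mult_INR (_ : INR 2 = 2%R) //.
  apply: Rle_trans jw; rewrite Rmult_comm; apply: Rmult_le_compat_l => //; exact: pos_INR.
Qed.

(** For [w] between 1 and 2 the constant is not preserved, but [exp w >= 2]. A single step with
    [D = 36] therefore starts from the previous bound at [exp w], and [216 = 6 * 36]. *)
Lemma bell_lower_tower1 k p w : (1 <= w)%R -> (INR p <= iter k exp w)%R ->
  ((INR p / (216 * w)) ^ p <= INR (bell_k k p))%R.
Proof.
move=> w1 le_p; have P0 := pos_INR p.
case: k le_p => [|k] le_p.
  apply: Rle_trans (bell_ge1 _ _); apply: pow_le1; split.
    by apply: Rmult_le_pos => //; apply/Rlt_le/Rinv_0_lt_compat; lra.
  apply: (Rmult_le_reg_r (216 * w)); first lra.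
  by rewrite /Rdiv Rmult_assoc Rinv_l; rewrite /= in le_p; lra.
rewrite (_ : 216 * w = 6 * 36 * w)%R; last ring.
apply: (@bell_lower_step k p 36); [lra|lra|lra| |].
- move=> j j0 jp; apply: bell_lower_tower; first by have := exp_ineq1_le w; lra.
  by rewrite -iterSr; apply: Rle_trans le_p; apply/le_INR/leP.
- move=> j jw; apply: Rle_pow; first lra.
  apply: INR_le; apply: Rle_trans jw; rewrite -{1}(Rmult_1_r (INR j)).
  by apply: Rmult_le_compat_l; [apply: pos_INR|].
Qed.

(* Half of the elements are merged during half of the [n] levels, and the
   other half recursively during the remaining levels. *)
Lemma bell_lower_levels k0 P D : (81 <= D)%R ->
  (forall j, (0 < j)%N -> (j <= P)%N -> ((INR j / D) ^ j <= INR (bell_k k0 j))%R) ->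
  forall p n, (0 < p)%N -> (p <= P)%N -> (0 < n)%N ->
  ((INR p / D) ^ p * INR n ^ p.-1 <= INR (bell_k (k0 + n) p))%R.
Proof.
move=> D81 base p; have [N] := ubnP p; elim: N p => // N IH p lt_pN n p0 pP n0.
have [p1|p2] := leqP p 1.
  have -> : p = 1%N by apply/eqP; rewrite eqn_leq p1 p0.
  rewrite /= !Rmult_1_r; apply: Rle_trans (bell_ge1 _ _).
  apply: (Rmult_le_reg_r D); first lra.
  by rewrite /Rdiv Rmult_assoc Rinv_l; lra.
have [n1|n2] := leqP n 1.
  have -> : n = 1%N by apply/eqP; rewrite eqn_leq n1 n0.
  rewrite pow1 Rmult_1_r; apply: Rle_trans (base _ p0 pP) _.
  by have := bell_lower_real k0 1 (leqnn p); rewrite subnn /= Rmult_1_l.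
(* Rounding down ensures [j <= p - j], while [j] is still at least [p / 3] and both [m] and [n'] are
   at least [n / 3]. *)
pose j := p./2; pose m := n./2; pose n' := n - m.
have [j0 jp] : (0 < j /\ j < p)%N.
  by rewrite /j; split; [rewrite half_gt0 | rewrite ltn_half_double -addnn -{1}(addn0 p) ltn_add2l].
have jq : (j <= p - j)%N.
  by rewrite leq_subRL ?(ltnW jp) // addnn /j -[X in _ <= X](odd_double_half p) leq_addl.
have p3 : (p <= j * 3)%N.
  rewrite /j -{1}(odd_double_half p) -/j -mul2n mulnC (mulnDr j 2 1) muln1 addnC leq_add2l.
  by case: (odd p); rewrite ?(ltnW j0) ?j0.
have m0 : (0 < m)%N by rewrite half_gt0.
have mn : (m <= n)%N by rewrite /m -{2}(odd_double_half n) -addnn addnA leq_addl.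
have n3 : (n <= m * 3)%N.
  rewrite /m -{1}(odd_double_half n) -/m -mul2n mulnC (mulnDr m 2 1) muln1 addnC leq_add2l.
  by case: (odd n); rewrite ?(ltnW m0) ?m0.
have mn' : (m <= n')%N by rewrite leq_subRL // addnn /m -[X in _ <= X](odd_double_half n) leq_addl.
have n'0 : (0 < n')%N by apply: leq_trans m0 mn'.
have IHj := IH j (leq_trans jp lt_pN) n' j0 (leq_trans (ltnW jp) pP) n'0.
have h := bell_lower_real (k0 + n') m (ltnW jp).
rewrite -addnA subnK // in h; apply: Rle_trans h.
have {}IHj := Rmult_le_compat_l _ _ _
  (pow_le (INR j * INR m) (p - j) (Rmult_le_pos _ _ (pos_INR j) (pos_INR m))) IHj.
apply: Rle_trans IHj.
have P1 := INR_ge1 p0; have N1 := INR_ge1 n0.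
have toR a b : (a <= b * 3)%N -> (INR a / 3 <= INR b)%R.
  by move=> /leP /le_INR; rewrite mult_INR (_ : INR 3 = 3%R) /=; lra.
have {}p3 := toR _ _ p3; have {}n3 := toR _ _ n3.
have n'3 : (INR n / 3 <= INR n')%R by apply: Rle_trans n3 _; apply/le_INR/leP.
set q := p - j in jq *; set i := j.-1.
have jE : j = i.+1 by rewrite prednK.
have pE : p = q + j by rewrite /q subnK // ltnW.
have p1E : p.-1 = q + i by rewrite pE jE addnS.
move: (INR p) (INR n) (INR j) (INR m) (INR n') P1 N1 p3 n3 n'3 => X Y J M L X1 Y1 XJ YM YL.
rewrite p1E {1}pE -plusE !pow_add.
apply: (Rle_trans _ ((X / 3 * (Y / 3)) ^ q * ((X / 3 / D) ^ j * (Y / 3) ^ i))%R); last first.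
  apply: Rmult_le_compat.
  - by apply: pow_le; apply: Rmult_le_pos; lra.
  - apply: Rmult_le_pos; apply: pow_le; last lra.
    by apply: Rmult_le_pos; [lra|apply/Rlt_le/Rinv_0_lt_compat; lra].
  - apply: pow_incr; split; first by apply: Rmult_le_pos; lra.
    by apply: Rmult_le_compat; lra.
  - have iD : (0 < / D)%R by apply: Rinv_0_lt_compat; lra.
    apply: Rmult_le_compat; [| |apply: pow_incr|apply: pow_incr; lra].
    + by apply: pow_le; apply: Rmult_le_pos; lra.
    + by apply: pow_le; lra.
    + by split; [apply: Rmult_le_pos; lra|apply: Rmult_le_compat_r; lra].
have -> : (X / 3 * (Y / 3) = X / D * Y * (D / 9))%R by field; lra.
have -> : (X / 3 / D = X / D * / 3)%R by field; lra.
rewrite /(Rdiv Y) !Rpow_mult_distr.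
have XD : (0 < X / D)%R by apply: Rdiv_lt_0_compat; lra.
have Z0 : (0 < (X / D) ^ q * Y ^ q * ((X / D) ^ j * Y ^ i))%R.
  by apply: Rmult_lt_0_compat; apply: Rmult_lt_0_compat; apply: pow_lt; lra.
(* Here [D >= 81] enters: [(D / 9) ^ q >= 9 ^ q] outweighs the losses [3 ^ j] and [3 ^ i], because
   [j] and [i] are at most [q]. *)
have key : (1 <= (D / 9) ^ q * ((/ 3) ^ j * (/ 3) ^ i))%R.
  apply: (Rle_trans _ (9 ^ q * ((/ 3) ^ q * (/ 3) ^ q))%R).
    by rewrite -!Rpow_mult_distr (_ : 9 * (/ 3 * / 3) = 1)%R ?pow1; [apply: Rle_refl|field].
  have dec a b : (a <= b)%N -> ((/ 3) ^ b <= (/ 3) ^ a)%R.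
    move=> /leP le_ab; rewrite !pow_inv; apply: Rinv_le_contravar; first by apply: pow_lt; lra.
    by apply: Rle_pow => //; lra.
  have t0 b : (0 <= (/ 3) ^ b)%R by apply: pow_le; lra.
  apply: Rmult_le_compat; [by apply: pow_le; lra|exact: Rmult_le_pos|by apply: pow_incr; lra|].
  by apply: Rmult_le_compat => //; apply: dec => //; apply: leq_trans jq; rewrite jE.
have := Rmult_le_compat_l _ _ _ (Rlt_le _ _ Z0) key.
by rewrite /Rdiv !Rpow_mult_distr; lra.
Qed.

(** * Comparison of the two forms of the bound for [k0 < k] *)

Lemma Rpower_double_le x y a : (0 < x)%R -> (0 < y <= 2 * x)%R -> (0 <= a <= 1)%R ->
  (Rpower y a <= 2 * Rpower x a)%R.
Proof.
move=> x0 [y0 yx] a01; have r0 : (0 < Rpower x a)%R by apply: exp_pos.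
apply: (Rle_trans _ (Rpower (2 * x) a)); first by apply: Rle_Rpower_l; lra.
rewrite -Rpower_mult_distr; [|lra|lra]; apply: Rmult_le_compat_r; first lra.
by rewrite -{2}(Rpower_1 2); [apply: Rle_Rpower; lra|lra].
Qed.

Lemma one_sub_inv01 p : (0 < p)%N -> (0 <= 1 - 1 / INR p <= 1)%R.
Proof.
move=> p0; have P1 := INR_ge1 p0; have : (0 < / INR p <= 1)%R; last lra.
split; first by apply: Rinv_0_lt_compat; lra.
by rewrite -Rinv_1; apply: Rinv_le_contravar; lra.
Qed.

Section LevelMin.

Variables p k k0 : nat.
Hypotheses (p0 : (0 < p)%N) (k0p : (k0 <= p)%N) (k0k : (k0 < k)%N).

Let a := (1 - 1 / INR p)%R.
Let n := k - k0.

Let a01 : (0 <= a <= 1)%R := one_sub_inv01 p0.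

Let n0 : (0 < n)%N. Proof. by rewrite subn_gt0. Qed.

Lemma root_le_min : (Rpower (INR n) a <= Rmin (Rpower (INR k) a) (INR n))%R.
Proof.
have N1 := INR_ge1 n0; apply: Rmin_glb.
  by apply: Rle_Rpower_l; [lra|split; [lra|apply/le_INR/leP/leq_subr]].
by rewrite -{2}(Rpower_1 (INR n)); [apply: Rle_Rpower; lra|lra].
Qed.

(** If [k0 <= n], then [k <= 2 * n] and the first argument of the minimum is small enough. Otherwise
    [n < k0 <= p < 3 ^ p], so the [p]-th root of [n] is at most 3. *)
Lemma min_le_root : (Rmin (Rpower (INR k) a) (INR n) <= 3 * Rpower (INR n) a)%R.
Proof.
have N1 := INR_ge1 n0; have r0 : (0 < Rpower (INR n) a)%R by apply: exp_pos.
have [le_k0n|lt_nk0] := leqP k0 n.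
  apply: Rle_trans (Rmin_l _ _) _.
  apply: (Rle_trans _ (2 * Rpower (INR n) a)); last lra.
  apply: Rpower_double_le => //; first lra.
  split; first exact/INR_gt0/(leq_ltn_trans _ k0k).
  rewrite -(_ : INR 2 = 2%R) // -mult_INR; apply/le_INR/leP.
  by rewrite multE mul2n -addnn -{1}(subnK (ltnW k0k)) leq_add2l.
apply: Rle_trans (Rmin_r _ _) _.
have e : INR n = (Rpower (INR n) (1 / INR p) * Rpower (INR n) a)%R.
  rewrite -Rpower_plus /a (_ : (1 / INR p + (1 - 1 / INR p) = 1)%R); last ring.
  by rewrite Rpower_1 //; lra.
rewrite {1}e; apply: Rmult_le_compat_r; first lra.
apply: root_le => //; first lra.
rewrite -(_ : INR 3 = 3%R) -?INR_expn; last by rewrite /=; lra.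
apply/le_INR/leP; apply: leq_trans (ltnW lt_nk0) _; apply: leq_trans k0p _.
exact/ltnW/ltn_expl.
Qed.

End LevelMin.

Theorem theorem4 :
  exists c C : R, (0 < c)%R /\ (0 < C)%R /\
  forall (p k k0 : nat), (2 <= p)%N -> (1 <= k)%N ->
    is_logstar (INR p) k0.+1 ->
    let bp := Rpower (INR (bell_k k p)) (1 / INR p) in
    ((k <= k0)%N ->
       (c * (INR p / iter_ln k (INR p)) <= bp /\
        bp <= C * (INR p / iter_ln k (INR p)))%R) /\
    ((k0 < k)%N ->
       (c * (INR p * Rpower (INR (k - k0)) (1 - 1 / INR p)) <= bp /\
        bp <= C * (INR p * Rpower (INR (k - k0)) (1 - 1 / INR p)) /\
        c * (INR p * Rmin (Rpower (INR k) (1 - 1 / INR p)) (INR (k - k0))) <= bp /\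
        bp <= C * (INR p * Rmin (Rpower (INR k) (1 - 1 / INR p)) (INR (k - k0))))%R).
Proof.
(* [648 = 3 * 216] and [18 = 3 * 6], where 3 is the ratio in [min_le_root]. *)
exists (/ 648)%R, 18%R; split; first lra; split; first lra.
move=> p k k0 p2 k1 [le1 gt1] bp; have p0 : (0 < p)%N by apply: ltnW.
have P1 := INR_ge1 p0; have e3 := exp_le_3.
have big_iter i : (i <= k0)%N -> iter i exp (iter_ln i (INR p)) = INR p.
  by move=> le_i; apply: iter_exp_ln => l lt_li; apply/gt1/(leq_trans lt_li)/leqW.
split=> [le_k|lt_k].
  have w1 := gt1 k le_k; have wE := big_iter k le_k.
  set w := iter_ln k (INR p) in w1 wE *.
  have Pw : (0 < INR p / w)%R by apply: Rdiv_lt_0_compat; lra.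
  split.
    apply: (Rle_trans _ (INR p / (216 * w))).
      by rewrite (_ : (INR p / (216 * w) = / 216 * (INR p / w))%R); [lra|field; lra].
    apply: root_ge => //; first by apply: Rdiv_lt_0_compat; lra.
    by apply: bell_lower_tower1; lra.
  apply: (Rle_trans _ (exp 1 * (INR p / w))); last by apply: Rmult_le_compat_r; lra.
  apply: bell_root_le_exp => //; first lra.
  by have := iter_expm1_le_exp k w; lra.
have w1 := gt1 k0 (ltnSn k0); have wE := big_iter k0 (leqnn k0).
set w := iter_ln k0 (INR p) in w1 wE *.
(* The next logarithm [ln w] is at most 1, so [w <= exp 1]. *)
have w3 : (w <= 3)%R.
  move: le1; rewrite /iter_ln iterS -/(iter_ln k0 (INR p)) -/w => /exp_le.
  by rewrite exp_ln; lra.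
have k0p : (k0 <= p)%N.
  apply/leP/INR_le; have := @iter_ln_le k0 (INR p) (fun i lt_i => gt1 i (leqW lt_i)).
  by rewrite -/w; lra.
have kE : k = k0 + (k - k0) by rewrite subnKC // ltnW.
have n0 : (0 < k - k0)%N by rewrite subn_gt0.
have lo_min := root_le_min p0 lt_k; have hi_min := min_le_root p0 k0p lt_k.
have lo : (/ 108 * (INR p * Rpower (INR (k - k0)) (1 - 1 / INR p)) <= bp)%R.
  have r0 : (0 < Rpower (INR (k - k0)) (1 - 1 / INR p))%R by apply: exp_pos.
  rewrite -Rmult_assoc (_ : (/ 108 * INR p = INR p / 108)%R); last by field.
  apply: root_ge => //; first by apply: Rmult_lt_0_compat; lra.
  rewrite Rpow_mult_distr root_expn_pred // kE.
  rewrite {1}(_ : k0 + _ - k0 = k - k0); last by rewrite -kE.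
  apply: (@bell_lower_levels k0 p) => //; first lra.
  (* As [w] may be below 2, the tower bound is taken at 3, which is admissible since [w <= 3]. *)
  move=> j j0 jp; rewrite (_ : 108 = 36 * 3)%R; last ring.
  apply: bell_lower_tower; first lra.
  apply: (Rle_trans _ (INR p)); first exact/le_INR/leP.
  by rewrite -{1}wE; apply: iter_exp_le.
have hi : (bp <= 6 * (INR p * Rmin (Rpower (INR k) (1 - 1 / INR p)) (INR (k - k0))))%R.
  (* For [k ^ (1 - 1/p)] the constant is [2 * 2], the second 2 coming from [k + 1 <= 2 * k]; for
     [k - k0] it is [3 * 2], from [exp 1 <= 3] and [n + 1 <= 2 * n]. *)
  rewrite /Rmin; case: Rle_dec => _.
    have := bell_root_le_levels k p0; rewrite -/bp => /Rle_trans; apply.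
    have K1 := INR_ge1 k1; have S1 := S_INR k.
    have : (Rpower (INR k.+1) (1 - 1 / INR p) <= 2 * Rpower (INR k) (1 - 1 / INR p))%R.
      apply: Rpower_double_le; rewrite ?S1; [lra|lra|exact: one_sub_inv01].
    have r0 : (0 < Rpower (INR k) (1 - 1 / INR p))%R by apply: exp_pos.
    move=> h; have := Rmult_le_compat_l (INR p) _ _ ltac:(lra) h.
    have := Rmult_lt_0_compat _ _ (Rlt_le_trans _ _ _ Rlt_0_1 P1) r0.
    lra.
  have N1 := INR_ge1 n0; set n := k - k0 in kE n0 N1 *; have S1 := S_INR n.
  have x0 : (0 < / INR n.+1)%R by apply: Rinv_0_lt_compat; lra.
  have e0 := exp_pos 1.
  (* Starting from [x = 1 / (n + 1)], the first [n] iterations of [expm1] reach at most 1, hence at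
     most [w], and the other [k0] reach at most [p]. *)
  apply: (Rle_trans _ (exp 1 * (INR p / / INR n.+1))).
    apply: bell_root_le_exp => //.
    rewrite kE iterD; apply: (Rle_trans _ (iter k0 expm1 w)).
      apply: iter_expm1_le; have := @iter_expm1_inv_le n (INR n.+1) ltac:(lra).
      by rewrite S1 (_ : (INR n + 1 - INR n = 1)%R) ?Rinv_1; [lra|ring].
    by have := iter_expm1_le_exp k0 w; lra.
  rewrite /Rdiv Rinv_inv S1.
  apply: (Rle_trans _ (3 * (INR p * (2 * INR n)))); last lra.
  apply: Rmult_le_compat; [lra| |lra|].
    by apply: Rmult_le_pos; lra.
  by apply: Rmult_le_compat_l; lra.
have := Rmult_le_compat_l (INR p) _ _ ltac:(lra) lo_min.
have := Rmult_le_compat_l (INR p) _ _ ltac:(lra) hi_min.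
have r0 : (0 < Rpower (INR (k - k0)) (1 - 1 / INR p))%R by apply: exp_pos.
have := Rmult_lt_0_compat _ _ (Rlt_le_trans _ _ _ Rlt_0_1 P1) r0.
by move=> *; repeat split; lra.
Qed.
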